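(* Let $(A,(d))$ be a transversal $\mathcal{O}_E$-prism. Then given any $h\geq 0$, $$\varphi_q(d^mA\langle d/\pi\rangle)\subseteq A+d^{m+h}A\langle d/\pi\rangle$$ for all $m\gg 0$ (depending only on $h$).
   Context: $E$ is a (fixed) finite extension of $\mathbf{Q}_p$ with uniformizer $\pi$ and residue field $\mathbf{F}_q$. A $\delta_E$-ring is an $\mathcal{O}_E$-algebra $A$ with a map $\delta_E:A\to A$ satisfying $\delta_E(xy)=x^q\delta_E(y)+y^q\delta_E(x)+\pi\delta_E(x)\delta_E(y)$, $\delta_E(x+y)=\delta_E(x)+\delta_E(y)+\frac{x^q+y^q-(x+y)^q}{\pi}$ and $\delta_E(a)=(a-a^q)/\pi$ for $a\in\mathcal{O}_E$; then $\varphi_q(x)=x^q+\pi\delta_E(x)$ is an $\mathcal{O}_E$-algebra endomorphism of $A$ lifting the $q$-power Frobenius mod $\pi$. An $\mathcal{O}_E$-prism is a pair $(A,I)$ with $A$ a $\delta_E$-ring, $I\subseteq A$ an ideal defining a Cartier divisor, $A$ derived $(\pi,I)$-complete, and $\pi\in I+\varphi_q(I)A$. It is transversal if $A/I$ is $\pi$-torsion free; then $A$ is itself $\pi$-torsion free. Writing $(A,(d))$ means $I=(d)$ with $d$ a nonzerodivisor. $A\langle d/\pi\rangle$ is the $\pi$-adic completion of the subring $A[d/\pi]\subseteq A[1/\pi]$; $\varphi_q$ extends naturally to it, and $A$ is regarded as a subring of it via the (injective) natural map. *)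

(* Defs.v *)
From HB Require Import structures.
From mathcomp Require Import all_boot all_order all_algebra all_field.
From mathcomp Require Import generic_quotient ring_quotient fraction ring boolp.

Set Implicit Arguments.
Unset Strict Implicit.
Unset Printing Implicit Defensive.

Import GRing.Theory.
Local Open Scope ring_scope.
Local Open Scope quotient_scope.

Section PrincipalQuotient.
Variables (R : comPzRingType) (y : R).

Definition pideal : {pred R} := fun a => `[< exists c, a = y * c >].

Lemma pidealP a : reflect (exists c, a = y * c) (a \in pideal).
Proof. by exact: asboolP. Qed.

Lemma pideal_zmod_closed : zmod_closed pideal.
Proof.
split=> [|a b /pidealP[c ->] /pidealP[e ->]]; apply/pidealP.
  by exists 0; rewrite mulr0.
by exists (c - e); rewrite mulrBr.
Qed.

HB.instance Definition _ := GRing.isZmodClosed.Build R pideal pideal_zmod_closed.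

(* [ring_quotient] only gives a ring structure to the quotient of a nonzero
   ring by a proper ideal; here both the ring and the quotient may be zero. *)
Definition pquot := {ideal_quot pideal}.
HB.instance Definition _ := GRing.Zmodule.on pquot.

Definition pquot_repr (u : pquot) : R := repr (u : {ideal_quot pideal}).
Definition to_pquot (a : R) : pquot := \pi_{ideal_quot pideal} a.

Lemma to_pquot_eq a b : to_pquot a = to_pquot b <-> exists c, a - b = y * c.
Proof.
split=> [/eqmodP|ab].
  by rewrite /= Quotient.equivE => /pidealP.
by apply/eqmodP; rewrite /= Quotient.equivE; apply/pidealP.
Qed.

Lemma pquot_reprK u : to_pquot (pquot_repr u) = u.
Proof. exact: reprK. Qed.

Lemma to_pquot_surj (u : pquot) : exists a, to_pquot a = u.
Proof. by exists (pquot_repr u); apply: pquot_reprK. Qed.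

Lemma to_pquot_is_zmod_morphism : zmod_morphism to_pquot.
Proof. by move=> a b; rewrite /to_pquot raddfB. Qed.

HB.instance Definition _ :=
  GRing.isZmodMorphism.Build R pquot to_pquot to_pquot_is_zmod_morphism.

Definition pquot_one : pquot := to_pquot 1.
Definition pquot_mul (u v : pquot) : pquot :=
  to_pquot (pquot_repr u * pquot_repr v).

Lemma to_pquotM a b : to_pquot (a * b) = pquot_mul (to_pquot a) (to_pquot b).
Proof.
have rep c : exists e, c - pquot_repr (to_pquot c) = y * e.
  by apply/to_pquot_eq; rewrite pquot_reprK.
have [c hc] := rep a; have [e he] := rep b.
apply/to_pquot_eq; exists (c * b + pquot_repr (to_pquot a) * e).
rewrite mulrDr mulrA -hc mulrCA -he mulrBl mulrBr.
by rewrite addrA subrK.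
Qed.

Lemma pquot_mulA : associative pquot_mul.
Proof.
move=> u v w; have [a <-] := to_pquot_surj u; have [b <-] := to_pquot_surj v.
by have [c <-] := to_pquot_surj w; rewrite -!to_pquotM mulrA.
Qed.

Lemma pquot_mulC : commutative pquot_mul.
Proof.
move=> u v; have [a <-] := to_pquot_surj u; have [b <-] := to_pquot_surj v.
by rewrite -!to_pquotM mulrC.
Qed.

Lemma pquot_mul1 : left_id pquot_one pquot_mul.
Proof.
by move=> u; have [a <-] := to_pquot_surj u; rewrite -to_pquotM mul1r.
Qed.

Lemma pquot_mulDl : left_distributive pquot_mul +%R.
Proof.
move=> u v w; have [a <-] := to_pquot_surj u; have [b <-] := to_pquot_surj v.
have [c <-] := to_pquot_surj w.
by rewrite -raddfD -!to_pquotM mulrDl raddfD.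
Qed.

HB.instance Definition _ := GRing.Zmodule_isComPzRing.Build pquot
  pquot_mulA pquot_mulC pquot_mul1 pquot_mulDl.

Lemma to_pquot_is_monoid_morphism : monoid_morphism to_pquot.
Proof. by split=> // a b; rewrite to_pquotM. Qed.

HB.instance Definition _ :=
  GRing.isMonoidMorphism.Build R pquot to_pquot to_pquot_is_monoid_morphism.

End PrincipalQuotient.

Section AdicCompletion.
Variables (R : comPzRingType) (x : R).

Definition pquot_trans n (u : pquot (x ^+ n.+1)) : pquot (x ^+ n) :=
  to_pquot (x ^+ n) (pquot_repr u).

Lemma pquot_transE n a : pquot_trans (to_pquot (x ^+ n.+1) a) = to_pquot _ a.
Proof.
have /to_pquot_eq[c hc] := pquot_reprK (to_pquot (x ^+ n.+1) a).
by apply/to_pquot_eq; exists (x * c); rewrite hc exprSr mulrA.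
Qed.

Lemma pquot_trans_is_zmod_morphism n : zmod_morphism (@pquot_trans n).
Proof.
move=> u v; have [a <-] := to_pquot_surj u; have [b <-] := to_pquot_surj v.
by rewrite -raddfB !pquot_transE raddfB.
Qed.

Lemma pquot_trans_is_monoid_morphism n : monoid_morphism (@pquot_trans n).
Proof.
split=> [|u v]; first by rewrite -(rmorph1 (to_pquot _)) pquot_transE rmorph1.
have [a <-] := to_pquot_surj u; have [b <-] := to_pquot_surj v.
by rewrite -rmorphM !pquot_transE rmorphM.
Qed.

HB.instance Definition _ n := GRing.isZmodMorphism.Build _ _ (@pquot_trans n)
  (@pquot_trans_is_zmod_morphism n).
HB.instance Definition _ n := GRing.isMonoidMorphism.Build _ _ (@pquot_trans n)
  (@pquot_trans_is_monoid_morphism n).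

Record adic := Adic {
  adic_val :> forall n, pquot (x ^+ n);
  adicP : forall n, pquot_trans (adic_val n.+1) = adic_val n }.

Lemma adic_eq (u v : adic) : (forall n, u n = v n) -> u = v.
Proof.
case: u v => [u hu] [v hv] /= uv.
have {}uv : u = v by apply: functional_extensionality_dep.
by subst v; congr Adic; apply: Prop_irrelevance.
Qed.

HB.instance Definition _ := gen_eqMixin adic.
HB.instance Definition _ := gen_choiceMixin adic.

Lemma adic_zeroP n : pquot_trans (0 : pquot (x ^+ n.+1)) = 0.
Proof. exact: rmorph0. Qed.
Lemma adic_oneP n : pquot_trans (1 : pquot (x ^+ n.+1)) = 1.
Proof. exact: rmorph1. Qed.
Lemma adic_oppP (u : adic) n : pquot_trans (- u n.+1) = - u n.
Proof. by rewrite rmorphN /= adicP. Qed.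
Lemma adic_addP (u v : adic) n : pquot_trans (u n.+1 + v n.+1) = u n + v n.
Proof. by rewrite rmorphD /= !adicP. Qed.
Lemma adic_mulP (u v : adic) n : pquot_trans (u n.+1 * v n.+1) = u n * v n.
Proof. by rewrite rmorphM /= !adicP. Qed.

Definition adic_zero := Adic adic_zeroP.
Definition adic_one := Adic adic_oneP.
Definition adic_opp (u : adic) := Adic (adic_oppP u).
Definition adic_add (u v : adic) := Adic (adic_addP u v).
Definition adic_mul (u v : adic) := Adic (adic_mulP u v).

Lemma adic_addA : associative adic_add.
Proof. by move=> u v w; apply: adic_eq => n /=; rewrite addrA. Qed.
Lemma adic_addC : commutative adic_add.
Proof. by move=> u v; apply: adic_eq => n /=; rewrite addrC. Qed.
Lemma adic_add0 : left_id adic_zero adic_add.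
Proof. by move=> u; apply: adic_eq => n /=; rewrite add0r. Qed.
Lemma adic_addN : left_inverse adic_zero adic_opp adic_add.
Proof. by move=> u; apply: adic_eq => n /=; rewrite addNr. Qed.

HB.instance Definition _ :=
  GRing.isZmodule.Build adic adic_addA adic_addC adic_add0 adic_addN.

Lemma adic_mulA : associative adic_mul.
Proof. by move=> u v w; apply: adic_eq => n /=; rewrite mulrA. Qed.
Lemma adic_mulC : commutative adic_mul.
Proof. by move=> u v; apply: adic_eq => n /=; rewrite mulrC. Qed.
Lemma adic_mul1 : left_id adic_one adic_mul.
Proof. by move=> u; apply: adic_eq => n /=; rewrite mul1r. Qed.
Lemma adic_mulDl : left_distributive adic_mul +%R.
Proof. by move=> u v w; apply: adic_eq => n /=; rewrite mulrDl. Qed.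

HB.instance Definition _ := GRing.Zmodule_isComPzRing.Build adic
  adic_mulA adic_mulC adic_mul1 adic_mulDl.

Definition to_adic (a : R) : adic := Adic (fun n => pquot_transE n a).

Lemma to_adic_is_zmod_morphism : zmod_morphism to_adic.
Proof. by move=> a b; apply: adic_eq => n /=; rewrite rmorphB. Qed.
Lemma to_adic_is_monoid_morphism : monoid_morphism to_adic.
Proof.
split=> [|a b]; apply: adic_eq => n /=; first by rewrite rmorph1.
by rewrite rmorphM.
Qed.

HB.instance Definition _ :=
  GRing.isZmodMorphism.Build R adic to_adic to_adic_is_zmod_morphism.
HB.instance Definition _ :=
  GRing.isMonoidMorphism.Build R adic to_adic to_adic_is_monoid_morphism.

End AdicCompletion.

Section Localization.
Variables (R : comPzRingType) (y : R).

(* The pair [(a, m)] stands for [a / y^m]. *)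
Definition away_equiv (u v : R * nat) : bool :=
  `[< exists k, y ^+ k * (y ^+ v.2 * u.1) = y ^+ k * (y ^+ u.2 * v.1) >].

Lemma away_equivP u v :
  reflect (exists k, y ^+ k * (y ^+ v.2 * u.1) = y ^+ k * (y ^+ u.2 * v.1))
          (away_equiv u v).
Proof. exact: asboolP. Qed.

Lemma away_equiv_is_equiv : equiv_class_of away_equiv.
Proof.
split=> [u|u v|v u w]; first by apply/away_equivP; exists 0%N.
  by apply/away_equivP/away_equivP => -[k hk]; exists k; rewrite hk.
move=> /away_equivP[k hk] /away_equivP[l hl]; apply/away_equivP.
exists (k + l + v.2)%N; rewrite !exprD.
transitivity (y ^+ l * y ^+ w.2 * (y ^+ k * (y ^+ v.2 * u.1))); first by ring.
rewrite hk.
transitivity (y ^+ k * y ^+ u.2 * (y ^+ l * (y ^+ w.2 * v.1))); first by ring.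
by rewrite hl; ring.
Qed.

Canonical away_equiv_equiv := EquivRelPack away_equiv_is_equiv.
Canonical away_equiv_encModRel := defaultEncModRel away_equiv.

Definition away := {eq_quot away_equiv}.
HB.instance Definition _ := Choice.on away.

Definition away_frac (a : R) (m : nat) : away := \pi_{eq_quot away_equiv} (a, m).

Lemma away_frac_eq a m b n : away_frac a m = away_frac b n <->
  exists k, y ^+ k * (y ^+ n * a) = y ^+ k * (y ^+ m * b).
Proof. by split=> [/eqmodP/away_equivP//|h]; apply/eqmodP/away_equivP. Qed.

Lemma away_fracP (u : away) : exists a m, u = away_frac a m.
Proof.
exists (repr (u : {eq_quot away_equiv})).1, (repr (u : {eq_quot away_equiv})).2.
by rewrite /away_frac -surjective_pairing reprK.
Qed.

Definition away_num (u : away) : R := (repr (u : {eq_quot away_equiv})).1.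
Definition away_exp (u : away) : nat := (repr (u : {eq_quot away_equiv})).2.

Lemma away_fracK u : away_frac (away_num u) (away_exp u) = u.
Proof. by rewrite /away_frac -surjective_pairing reprK. Qed.

Definition away_add (u v : away) : away :=
  away_frac (y ^+ away_exp v * away_num u + y ^+ away_exp u * away_num v)
            (away_exp u + away_exp v).
Definition away_opp (u : away) : away := away_frac (- away_num u) (away_exp u).
Definition away_mul (u v : away) : away :=
  away_frac (away_num u * away_num v) (away_exp u + away_exp v).

Lemma away_addE a m b n : away_add (away_frac a m) (away_frac b n) =
  away_frac (y ^+ n * a + y ^+ m * b) (m + n).
Proof.
have /away_frac_eq[k hk] := away_fracK (away_frac a m).
have /away_frac_eq[l hl] := away_fracK (away_frac b n).
rewrite /away_add; move: (away_num _) (away_exp _) hk (away_num _) (away_exp _) hl.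
move=> a' m' hk b' n' hl.
apply/away_frac_eq; exists (k + l)%N; rewrite !exprD.
transitivity (y ^+ l * y ^+ n * y ^+ n' * (y ^+ k * (y ^+ m * a')) +
              y ^+ k * y ^+ m * y ^+ m' * (y ^+ l * (y ^+ n * b'))); first by ring.
by rewrite hk hl; ring.
Qed.

Lemma away_oppE a m : away_opp (away_frac a m) = away_frac (- a) m.
Proof.
have /away_frac_eq[k hk] := away_fracK (away_frac a m).
by apply/away_frac_eq; exists k; rewrite !mulrN hk.
Qed.

Lemma away_mulE a m b n :
  away_mul (away_frac a m) (away_frac b n) = away_frac (a * b) (m + n).
Proof.
have /away_frac_eq[k hk] := away_fracK (away_frac a m).
have /away_frac_eq[l hl] := away_fracK (away_frac b n).
rewrite /away_mul; move: (away_num _) (away_exp _) hk (away_num _) (away_exp _) hl.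
move=> a' m' hk b' n' hl.
apply/away_frac_eq; exists (k + l)%N; rewrite !exprD.
transitivity ((y ^+ k * (y ^+ m * a')) * (y ^+ l * (y ^+ n * b'))); first by ring.
by rewrite hk hl; ring.
Qed.

Lemma away_addA : associative away_add.
Proof.
move=> u v w; have [a [m ->]] := away_fracP u; have [b [n ->]] := away_fracP v.
have [c [o ->]] := away_fracP w; rewrite !away_addE addnA !exprD.
by congr away_frac; ring.
Qed.

Lemma away_addC : commutative away_add.
Proof.
move=> u v; have [a [m ->]] := away_fracP u; have [b [n ->]] := away_fracP v.
by rewrite !away_addE addnC addrC.
Qed.

Lemma away_add0 : left_id (away_frac 0 0) away_add.
Proof.
move=> u; have [a [m ->]] := away_fracP u.
by rewrite away_addE mulr0 add0r mul1r.
Qed.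

Lemma away_addN : left_inverse (away_frac 0 0) away_opp away_add.
Proof.
move=> u; have [a [m ->]] := away_fracP u; rewrite away_oppE away_addE.
by apply/away_frac_eq; exists 0%N; ring.
Qed.

HB.instance Definition _ :=
  GRing.isZmodule.Build away away_addA away_addC away_add0 away_addN.

Lemma away_mulA : associative away_mul.
Proof.
move=> u v w; have [a [m ->]] := away_fracP u; have [b [n ->]] := away_fracP v.
by have [c [o ->]] := away_fracP w; rewrite !away_mulE addnA mulrA.
Qed.

Lemma away_mulC : commutative away_mul.
Proof.
move=> u v; have [a [m ->]] := away_fracP u; have [b [n ->]] := away_fracP v.
by rewrite !away_mulE addnC mulrC.
Qed.

Lemma away_mul1 : left_id (away_frac 1 0) away_mul.
Proof.
by move=> u; have [a [m ->]] := away_fracP u; rewrite away_mulE mul1r.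
Qed.

Lemma away_mulDl : left_distributive away_mul +%R.
Proof.
move=> u v w; have [a [m ->]] := away_fracP u; have [b [n ->]] := away_fracP v.
have [c [o ->]] := away_fracP w.
rewrite -[_ + _]/(away_add _ _) -[RHS]/(away_add _ _) !(away_addE, away_mulE).
by apply/away_frac_eq; exists 0%N; rewrite !exprD; ring.
Qed.

HB.instance Definition _ := GRing.Zmodule_isComPzRing.Build away
  away_mulA away_mulC away_mul1 away_mulDl.

Definition to_away (a : R) : away := away_frac a 0.

Lemma to_away_is_zmod_morphism : zmod_morphism to_away.
Proof.
move=> a b; rewrite -[RHS]/(away_add _ (away_opp _)) away_oppE away_addE.
by rewrite !mul1r.
Qed.
Lemma to_away_is_monoid_morphism : monoid_morphism to_away.
Proof. by split=> // a b; rewrite -[RHS]/(away_mul _ _) away_mulE. Qed.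

HB.instance Definition _ :=
  GRing.isZmodMorphism.Build R away to_away to_away_is_zmod_morphism.
HB.instance Definition _ :=
  GRing.isMonoidMorphism.Build R away to_away to_away_is_monoid_morphism.

End Localization.

Section Adjoin.
Variables (R S : comPzRingType) (f : {rmorphism R -> S}) (t : S).

Definition adjoin_pred : {pred S} := fun x =>
  `[< exists s : seq R, x = \sum_(i < size s) f s`_i * t ^+ i >].

Lemma adjoin_predP x :
  reflect (exists s : seq R, x = \sum_(i < size s) f s`_i * t ^+ i)
          (x \in adjoin_pred).
Proof. exact: asboolP. Qed.

Lemma adjoin_horner a x :
  x \in adjoin_pred -> f a + t * x \in adjoin_pred.
Proof.
move=> /adjoin_predP[s ->]; apply/adjoin_predP; exists (a :: s).
rewrite big_ord_recl /= mulr1 mulr_sumr; congr (_ + _).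
by apply: eq_bigr => i _; rewrite /bump /= add1n exprS mulrCA.
Qed.

Lemma adjoin_ind (P : S -> Prop) : P 0 ->
  (forall a x, x \in adjoin_pred -> P x -> P (f a + t * x)) ->
  forall x, x \in adjoin_pred -> P x.
Proof.
move=> P0 PX x /adjoin_predP[s ->].
elim: s => [|a s IHs]; first by rewrite big_ord0.
rewrite big_ord_recl /= mulr1.
rewrite (_ : \sum_(i < _) _ = t * \sum_(i < size s) f s`_i * t ^+ i).
  by apply: PX => //; apply/adjoin_predP; exists s.
rewrite mulr_sumr.
by apply: eq_bigr => i _; rewrite /bump /= add1n exprS mulrCA.
Qed.

Lemma adjoin0 : 0 \in adjoin_pred.
Proof. by apply/adjoin_predP; exists [::]; rewrite big_ord0. Qed.

Lemma adjoinC a : f a \in adjoin_pred.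
Proof. by rewrite -[f a]addr0 -(mulr0 t) adjoin_horner ?adjoin0. Qed.

Lemma adjoinX : t \in adjoin_pred.
Proof.
by rewrite -[t]mulr1 -(rmorph1 f) -[_ * _]add0r -(rmorph0 f) adjoin_horner ?adjoinC.
Qed.

Lemma adjoinB : {in adjoin_pred &, forall x y, x - y \in adjoin_pred}.
Proof.
move=> x y Sx; move: x Sx y.
apply: adjoin_ind => [|a x Sx IHx]; apply: adjoin_ind => [|b y Sy IHy].
- by rewrite subr0 adjoin0.
- rewrite (_ : _ - _ = f (- b) + t * (0 - y)) ?adjoin_horner //.
  by rewrite rmorphN; ring.
- by rewrite subr0 adjoin_horner.
rewrite (_ : _ - _ = f (a - b) + t * (x - y)) ?adjoin_horner ?IHx //.
by rewrite rmorphB; ring.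
Qed.

Lemma adjoinM : {in adjoin_pred &, forall x y, x * y \in adjoin_pred}.
Proof.
have SD x y : x \in adjoin_pred -> y \in adjoin_pred -> x + y \in adjoin_pred.
  by move=> Sx Sy; rewrite -[y]opprK -[- y]add0r !adjoinB ?adjoin0.
have SX x : x \in adjoin_pred -> t * x \in adjoin_pred.
  by move=> Sx; rewrite -[_ * _]add0r -(rmorph0 f) adjoin_horner.
have SZ a y : y \in adjoin_pred -> f a * y \in adjoin_pred.
  elim/adjoin_ind: y / => [|b y _ Sy]; first by rewrite mulr0 adjoin0.
  by rewrite mulrDr -rmorphM mulrCA adjoin_horner.
move=> x y + Sy; elim/adjoin_ind: x / => [|a x _ Sxy]; first by rewrite mul0r adjoin0.
by rewrite mulrDl -mulrA SD ?SZ ?SX.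
Qed.

Lemma adjoin_subring_closed : subring_closed adjoin_pred.
Proof.
by split; [rewrite -(rmorph1 f); apply: adjoinC | apply: adjoinB | apply: adjoinM].
Qed.

Record adjoin := Adjoin { adjoin_val :> S; _ : adjoin_val \in adjoin_pred }.

HB.instance Definition _ := [isSub for adjoin_val].
HB.instance Definition _ := [Choice of adjoin by <:].
HB.instance Definition _ := GRing.SubChoice_isSubComPzRing.Build S adjoin_pred
  adjoin adjoin_subring_closed.

Definition to_adjoin (a : R) : adjoin := Adjoin (adjoinC a).
Definition adjoin_gen : adjoin := Adjoin adjoinX.

Lemma to_adjoin_is_zmod_morphism : zmod_morphism to_adjoin.
Proof. by move=> a b; apply: val_inj; rewrite /= rmorphB. Qed.
Lemma to_adjoin_is_monoid_morphism : monoid_morphism to_adjoin.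
Proof.
by split=> [|a b]; apply: val_inj; rewrite /= ?rmorph1 ?rmorphM.
Qed.

HB.instance Definition _ :=
  GRing.isZmodMorphism.Build R adjoin to_adjoin to_adjoin_is_zmod_morphism.
HB.instance Definition _ :=
  GRing.isMonoidMorphism.Build R adjoin to_adjoin to_adjoin_is_monoid_morphism.

End Adjoin.

Section PadicInt.
Variables (p : nat) (p_pr : prime p).

(* The argument [p_pr] lets canonical structure inference find the instances
   below that depend on the primality of [p]. *)
Definition padic_int of prime p : Type := adic (p%:Z).
Local Notation Zp := (padic_int p_pr).
HB.instance Definition _ := GRing.ComPzRing.on Zp.

Lemma pquot_int_eq0 n (a : int) :
  to_pquot (p%:Z ^+ n) a = 0 <-> (p ^ n %| `|a|)%N.
Proof.
rewrite -(rmorph0 (to_pquot (p%:Z ^+ n))); split.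
  by case/to_pquot_eq=> c; rewrite subr0 => ->; rewrite abszM abszX dvdn_mulr.
move=> dv; apply/to_pquot_eq.
have /dvdzP[c ->] : (p%:Z ^+ n %| a)%Z by rewrite dvdzE abszX.
by exists c; rewrite subr0 mulrC.
Qed.

Lemma padic_int_nonzero : (1 : Zp) != 0.
Proof.
apply/eqP => /(congr1 (fun u : Zp => u 1%N)) /=.
rewrite -[X in X = _]/(to_pquot (p%:Z ^+ 1) (1 : int)) -[X in _ = X]/0.
by move/pquot_int_eq0; rewrite expn1 dvdn1 => /eqP p1; have := p_pr; rewrite p1.
Qed.

HB.instance Definition _ :=
  GRing.PzSemiRing_isNonZero.Build Zp padic_int_nonzero.

Definition padic_unit : {pred Zp} := fun u => `[< exists v, v * u = 1 >].
Definition padic_inv (u : Zp) : Zp :=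
  if pselect (exists v, v * u = 1) is left uV then projT1 (cid uV) else u.

Lemma padic_mulVx : {in padic_unit, left_inverse 1 padic_inv *%R}.
Proof. by move=> u /asboolP uV; rewrite /padic_inv; case: pselect => // ?; case: cid. Qed.

Lemma padic_unitPl (u v : Zp) : v * u = 1 -> padic_unit u.
Proof. by move=> vu; apply/asboolP; exists v. Qed.

Lemma padic_inv_out : {in [predC padic_unit], padic_inv =1 id}.
Proof.
move=> u /negP uV; rewrite /padic_inv; case: pselect => // uV'.
by case: uV; apply/asboolP.
Qed.

HB.instance Definition _ := GRing.ComNzRing_hasMulInverse.Build Zp
  padic_mulVx padic_unitPl padic_inv_out.

Lemma padic_coord (u : Zp) n k (a : int) :
  u (n + k)%N = to_pquot _ a -> u n = to_pquot _ a.
Proof.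
elim: k => [|k IHk]; first by rewrite addn0.
by rewrite addnS => uE; apply: IHk; rewrite -adicP uE pquot_transE.
Qed.

Lemma padic_int_domain : GRing.integral_domain_axiom Zp.
Proof.
move=> u v uv0; apply/orP.
have [[n un]|u0] := pselect (exists n, u n <> 0); last first.
  left; apply/eqP/adic_eq => n; apply: contrapT => un.
  by apply: u0; exists n.
have [[m vm]|v0] := pselect (exists n, v n <> 0); last first.
  right; apply/eqP/adic_eq => m; apply: contrapT => vm.
  by apply: v0; exists m.
exfalso; have [a au] := to_pquot_surj (u (n + m)%N).
have [b bv] := to_pquot_surj (v (n + m)%N).
have := congr1 (fun w : Zp => w (n + m)%N) uv0.
rewrite /= -au -bv -rmorphM => /pquot_int_eq0; rewrite abszM.
move: un vm; rewrite (padic_coord (esym au)).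
rewrite addnC in bv; rewrite (padic_coord (esym bv)) => un vm.
have {}un : ~~ (p ^ n %| `|a|)%N by apply/negP => /pquot_int_eq0.
have {}vm : ~~ (p ^ m %| `|b|)%N by apply/negP => /pquot_int_eq0.
have a0 : (0 < `|a|)%N by case: `|a|%N un => //; rewrite dvdn0.
have b0 : (0 < `|b|)%N by case: `|b|%N vm => //; rewrite dvdn0.
rewrite pfactor_dvdn ?muln_gt0 ?a0 // lognM //.
move: un vm; rewrite !pfactor_dvdn // -!ltnNge => an bm.
by rewrite leqNgt -addnS leq_add // ltnW.
Qed.

HB.instance Definition _ :=
  GRing.ComUnitRing_isIntegral.Build Zp padic_int_domain.

Definition padic : fieldType := {fraction Zp}.

End PadicInt.

Section RingOfIntegers.
Variables (p : nat) (p_pr : prime p) (E : fieldExtType (padic p_pr)).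

Definition padic_int_in : padic_int p_pr -> E :=
  in_alg E \o @FracField.tofrac (padic_int p_pr).
HB.instance Definition _ := GRing.RMorphism.on padic_int_in.

Definition OE_pred : {pred E} := fun x => `[< integralOver padic_int_in x >].

Lemma OE_subring_closed : subring_closed OE_pred.
Proof.
split=> [|x y /asboolP hx /asboolP hy|x y /asboolP hx /asboolP hy]; apply/asboolP.
- exact: integral1.
- exact: integral_sub.
- exact: integral_mul.
Qed.

Record OE := MkOE { OE_val :> E; _ : OE_val \in OE_pred }.

HB.instance Definition _ := [isSub for OE_val].
HB.instance Definition _ := [Choice of OE by <:].
HB.instance Definition _ :=
  GRing.SubChoice_isSubComNzRing.Build E OE_pred OE OE_subring_closed.

(* The quotient [a / b], computed in [E]; it is only meaningful when it is
   integral (the default value is [0]). *)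
Definition OE_div (a b : OE) : OE := insubd 0 (val a / val b).

(* [O_E] is local, so that its maximal ideal is the set of nonunits. *)
Definition is_uniformizer (pi : OE) : Prop :=
  forall x : OE, (exists y, x = pi * y) <-> ~ (exists y, x * y = 1).

Definition is_residue_map (pi : OE) (k : finFieldType)
    (red : {rmorphism OE -> k}) : Prop :=
  (forall z, exists x, red x = z) /\
  (forall x, red x = 0 <-> exists y, x = pi * y).

End RingOfIntegers.

Section Prisms.
Variables (p : nat) (p_pr : prime p) (E : fieldExtType (padic p_pr)).
Variables (pi : OE E) (q : nat).
(* The [O_E]-algebra structure of [A] is given by its structure map [iota],
   because [comAlgType] excludes the zero ring. *)
Variables (A : comPzRingType) (iota : {rmorphism OE E -> A}).

(* [(x^q + y^q - (x + y)^q) / pi] is the polynomial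
   [- \sum_(0 < i < q) ('C(q, i) / pi) x^(q - i) y^i] with coefficients in
   [O_E], which makes sense even if [A] has [pi]-torsion. *)
Record is_delta (delta : A -> A) : Prop := IsDelta {
  deltaM : forall x y, delta (x * y) =
    x ^+ q * delta y + y ^+ q * delta x + iota pi * delta x * delta y;
  deltaD : forall x y, delta (x + y) = delta x + delta y
    - \sum_(1 <= i < q) iota (OE_div 'C(q, i)%:R pi) * x ^+ (q - i) * y ^+ i;
  delta_OE : forall a : OE E, delta (iota a) = iota (OE_div (a - a ^+ q) pi) }.

Definition frob (delta : A -> A) (x : A) : A := x ^+ q + iota pi * delta x.

(* The derived limit of [... --f--> A --f--> A] is the cone of this map, so it
   vanishes if and only if the map is bijective. *)
Definition derived_complete_at (f : A) : Prop :=
  bijective (fun (x : nat -> A) (n : nat) => x n - f * x n.+1).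

Definition derived_complete (J : A -> Prop) : Prop :=
  forall f, J f -> derived_complete_at f.

(* The ideal [I] is [(d)], so that [frob I A] is generated by [frob d]. *)
Record is_prism (delta : A -> A) (d : A) : Prop := IsPrism {
  prism_delta : is_delta delta;
  prism_nonzerodivisor : forall x, d * x = 0 -> x = 0;
  prism_complete :
    derived_complete (fun f => exists a b, f = iota pi * a + d * b);
  prism_pi : exists a b, iota pi = d * a + frob delta d * b }.

Definition transversal_prism (d : A) : Prop :=
  forall x, (exists y, iota pi * x = d * y) -> exists z, x = d * z.

End Prisms.

Section Dilatation.
Variables (A : comPzRingType) (d y : A).

Definition adjoin_frac : comPzRingType :=
  adjoin (to_away y : {rmorphism A -> away y}) (away_frac y d 1).

Definition to_adjoin_frac : {rmorphism A -> adjoin_frac} :=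
  @to_adjoin A (away y) (to_away y) (away_frac y d 1).

Definition adjoin_frac_hat : comPzRingType := adic (to_adjoin_frac y).

(* [y] is invertible in [away y] and not a zero divisor in [adjoin_frac_hat],
   which is [y]-adically separated: a ring endomorphism of [adjoin_frac_hat]
   that fixes [y] is determined by its composite with this map. *)
Definition to_adjoin_frac_hat : {rmorphism A -> adjoin_frac_hat} :=
  to_adic (to_adjoin_frac y) \o to_adjoin_frac.

End Dilatation.

(* Main.v *)
(** Put [u = d/pi] and [b = delta d]. As [phi d = d^q + pi b], we get
    [phi u = d^(q-1) u + b] and [phi (d^m u^i) = pi^m (d^(q-1) u + b)^(m+i)].
    In the binomial expansion, [pi^m (d^(q-1) u)^l] lies in [A] for [l <= m], and
    equals [d^(m + (q-1) l) u^(l-m)] for [l >= m], which is divisible by [d^(m+h)]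
    as soon as [h <= m]. An element of the completion is a series
    [\sum_k pi^k x_k] with [x_k] in [A[d/pi]], and the resulting series of elements
    of [A] converges in [A] because [A] is derived [pi]-complete. *)
Require Import Defs.
From mathcomp Require Import all_boot all_order all_algebra all_field.
From mathcomp Require Import ring boolp.

Set Implicit Arguments.
Unset Strict Implicit.
Unset Printing Implicit Defensive.

Import GRing.Theory.
Local Open Scope ring_scope.

(** * Convergent series in the adic completion *)

Section AdicSeries.
Variables (R : comPzRingType) (x : R).
Local Notation X := (to_adic x x).

Lemma to_pquot_exp n : to_pquot (x ^+ n) (x ^+ n) = 0.
Proof.
rewrite -(rmorph0 (to_pquot (x ^+ n))).
by apply/to_pquot_eq; exists 1; rewrite subr0 mulr1.
Qed.

Lemma adic_coordX n k : (X ^+ k : adic x) n = to_pquot (x ^+ n) (x ^+ k).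
Proof. by rewrite -rmorphXn. Qed.

Lemma adic_coord_sum n m (b : nat -> adic x) :
  (\sum_(l < m) X ^+ l * b l : adic x) n =
  \sum_(l < m) to_pquot (x ^+ n) (x ^+ l) * b l n.
Proof.
elim: m => [|m IHm]; first by rewrite !big_ord0.
by rewrite !big_ord_recr /= -IHm -adic_coordX.
Qed.

(** Series are handled through their tails [T k]. Unrolling the recursion [n] times leaves the
    remainder [X ^+ n * T n], which dies modulo [x ^+ n]. *)
Lemma adic_iter (b T : nat -> adic x) :
  (forall k, T k = b k + X * T k.+1) ->
  forall n, T 0%N n = \sum_(l < n) to_pquot (x ^+ n) (x ^+ l) * b l n.
Proof.
move=> hT n.
have -> : T 0%N = \sum_(l < n) X ^+ l * b l + X ^+ n * T n.
  elim: n => [|n IHn]; first by rewrite big_ord0 add0r mul1r.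
  by rewrite IHn big_ord_recr /= {1}hT exprSr; ring.
rewrite -[LHS]/((\sum_(l < n) X ^+ l * b l : adic x) n + (X ^+ n : adic x) n * T n n).
by rewrite adic_coordX to_pquot_exp mul0r addr0 adic_coord_sum.
Qed.

Lemma adic_separated (e : nat -> adic x) :
  (forall k, e k = X * e k.+1) -> e 0%N = 0.
Proof.
move=> he; apply: adic_eq => n.
rewrite (@adic_iter (fun=> 0) e) => [|k]; last by rewrite add0r.
by rewrite big1 // => l _; rewrite mulr0.
Qed.

Lemma adic_series (b : nat -> adic x) :
  exists T : nat -> adic x, forall k, T k = b k + X * T k.+1.
Proof.
pose t k n := \sum_(l < n) to_pquot (x ^+ n) (x ^+ l) * b (k + l)%N n.
have tP k n : pquot_trans (t k n.+1) = t k n.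
  rewrite rmorph_sum big_ord_recr /= !rmorphM /= pquot_transE to_pquot_exp mul0r addr0.
  by apply: eq_bigr => l _; rewrite rmorphM /= pquot_transE adicP.
exists (fun k => Adic (tP k)) => k; apply: adic_eq => n.
rewrite -[LHS]/(t k n) -[RHS]/(b k n + to_pquot (x ^+ n) x * t k.+1 n).
(* The extra term [l = n] vanishes modulo [x ^+ n]; with it, the term [l = 0] can be split off. *)
transitivity (\sum_(l < n.+1) to_pquot (x ^+ n) (x ^+ l) * b (k + l)%N n).
  by rewrite big_ord_recr /= to_pquot_exp mul0r addr0.
rewrite big_ord_recl /= addn0 rmorph1 mul1r mulr_sumr; congr (_ + _).
by apply: eq_bigr => l _; rewrite /bump /= add1n exprS rmorphM mulrA addnS.
Qed.

(** The digits are the differences of successive representatives of [y], divided by [x ^+ n]; the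
    partial sums telescope. *)
Lemma adic_expansion (y : adic x) :
  exists (c : nat -> R) (T : nat -> adic x),
    T 0%N = y /\ forall k, T k = to_adic x (c k) + X * T k.+1.
Proof.
have /choice[c hc] : forall n, exists c,
    pquot_repr (y n.+1) - pquot_repr (y n) = x ^+ n * c.
  move=> n; apply/to_pquot_eq.
  by rewrite pquot_reprK -[in RHS]adicP.
pose r0 := pquot_repr (y 0%N).
(* The digit 0 also absorbs the starting representative [r0], so the first [n.+1] terms sum to the
   representative at level [n.+1]. *)
pose c' n := if n is 0%N then r0 + c 0%N else c n.
have [T hT] := adic_series (fun k => to_adic x (c' k)).
exists c', T; split=> //; apply: adic_eq => n; rewrite (adic_iter hT).
transitivity (to_pquot (x ^+ n) (\sum_(l < n) x ^+ l * c' l)).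
  by rewrite rmorph_sum; apply: eq_bigr => l _; rewrite rmorphM.
case: n => [|n].
  rewrite -(pquot_reprK (y 0%N)); apply/to_pquot_eq.
  by exists (0 - r0); rewrite big_ord0 mul1r.
rewrite -[RHS]pquot_reprK; congr to_pquot.
elim: n => [|n IHn].
  by rewrite big_ord1 /= mul1r /r0 -[c 0%N]mul1r -[1]/(x ^+ 0) -hc addrC subrK.
by rewrite big_ord_recr /= IHn -hc addrC subrK.
Qed.

(** Cancelling [x] costs one level: [x * r] divisible by [x ^+ n.+1] makes [r] divisible by
    [x ^+ n], hence [y n = 0]. *)
Lemma adic_torsion_free : (forall a, x * a = 0 -> a = 0) ->
  forall y : adic x, X * y = 0 -> y = 0.
Proof.
move=> xreg y Xy0; apply: adic_eq => n; rewrite -adicP.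
have [r yE] := to_pquot_surj (y n.+1); rewrite -yE pquot_transE.
have := congr1 (fun z : adic x => z n.+1) Xy0.
rewrite -[LHS]/(to_pquot (x ^+ n.+1) x * y n.+1) -yE -rmorphM.
rewrite -[RHS](rmorph0 (to_pquot (x ^+ n.+1))) => /to_pquot_eq[c].
rewrite subr0 exprS -mulrA => xr.
rewrite -[RHS](rmorph0 (to_pquot (x ^+ n))); apply/to_pquot_eq; exists c.
apply/eqP; rewrite subr0 -subr_eq0; apply/eqP/xreg.
by rewrite mulrBr xr subrr.
Qed.

End AdicSeries.

(** * Frobenius fixes the uniformizer *)

Lemma OE_divK (p : nat) (p_pr : prime p) (E : fieldExtType (padic p_pr))
  (pi a : OE E) : pi * OE_div (pi * a) pi = pi * a.
Proof.
apply: val_inj; rewrite !rmorphM /=.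
have [->|pi0] := eqVneq (val pi) 0; first by rewrite !mul0r.
have aE : val (pi * a) / val pi = val a by rewrite rmorphM mulrC mulKf.
(* The quotient is the integral element [a], so the default value of [OE_div] does not intervene. *)
by rewrite /OE_div aE valKd.
Qed.

Lemma frob_uniformizer (p : nat) (p_pr : prime p) (E : fieldExtType (padic p_pr))
  (pi : OE E) (q : nat) (A : comPzRingType) (iota : {rmorphism OE E -> A})
  (delta : A -> A) : (0 < q)%N -> is_delta pi q iota delta ->
  frob pi q iota delta (iota pi) = iota pi.
Proof.
case: q => // q _ dl; rewrite /frob (delta_OE dl) -rmorphXn -rmorphM /=.
rewrite (_ : pi - pi ^+ q.+1 = pi * (1 - pi ^+ q)); last by rewrite exprS; ring.
by rewrite OE_divK -rmorphD; congr (iota _); rewrite exprS; ring.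
Qed.

(** * Images of polynomials in [d/pi] *)

Section SumIdeal.
Variables (A B : comPzRingType) (j : {rmorphism A -> B}) (D : B).

(** The set [j A + D ^+ n B] is an [A]-submodule of [B], not an ideal in general. *)
Definition in_sum_ideal n (b : B) := exists a y, b = j a + D ^+ n * y.

Lemma in_sum_ideal0 n : in_sum_ideal n 0.
Proof. by exists 0, 0; rewrite rmorph0 mulr0 addr0. Qed.

Lemma in_sum_idealD n b c :
  in_sum_ideal n b -> in_sum_ideal n c -> in_sum_ideal n (b + c).
Proof.
move=> [a [y ->]] [a' [y' ->]]; exists (a + a'), (y + y').
by rewrite rmorphD; ring.
Qed.

Lemma in_sum_idealZ n a b : in_sum_ideal n b -> in_sum_ideal n (j a * b).
Proof.
move=> [a' [y ->]]; exists (a * a'), (j a * y).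
by rewrite rmorphM; ring.
Qed.

Lemma in_sum_ideal_exp (pi d e : A) (u : B) (q m h i : nat) :
  j d = D -> j pi * u = D -> (0 < q)%N -> (h <= m)%N ->
  in_sum_ideal (m + h) (j pi ^+ m * (D ^+ q * u + j e) ^+ (m + i)).
Proof.
move=> jd ju q0 hm; rewrite exprDn mulr_sumr.
apply: big_ind => [|b c|l _]; [exact: in_sum_ideal0|exact: in_sum_idealD|].
rewrite -mulrnAl; set N := 'C(_, _).
rewrite (_ : _ * _ = j (e ^+ l *+ N) * (j pi ^+ m * (D ^+ q * u) ^+ (m + i - l))).
  (* From here on [l] is the exponent of [D ^+ q * u] in the binomial term. *)
  apply: in_sum_idealZ; move: (m + i - l)%N => {e N l i} l.
  have [lm|ml] := leqP l m.
    exists (pi ^+ (m - l) * d ^+ (q * l + l)), 0; rewrite mulr0 addr0.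
    have pim : j pi ^+ m = j pi ^+ (m - l) * j pi ^+ l by rewrite -exprD subnK.
    have Dl : D ^+ l = j pi ^+ l * u ^+ l by rewrite -exprMn ju.
    by rewrite rmorphM !rmorphXn jd exprD Dl pim exprMn exprM; ring.
  exists 0, (D ^+ (q * l - h) * u ^+ (l - m)); rewrite rmorph0 add0r.
  (* The [h] additional factors [D] are taken from [D ^+ (q * l)], since [h <= m < l <= q * l]. *)
  have hq : (h <= q * l)%N.
    by apply: leq_trans hm (leq_trans (ltnW ml) _); rewrite leq_pmull.
  have Dm : D ^+ m = j pi ^+ m * u ^+ m by rewrite -exprMn ju.
  have ul : u ^+ l = u ^+ (l - m) * u ^+ m by rewrite -exprD (subnK (ltnW ml)).
  have Dql : D ^+ (q * l) = D ^+ (q * l - h) * D ^+ h by rewrite -exprD subnK.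
  by rewrite exprMn -exprM exprD Dm ul Dql; ring.
by rewrite rmorphMn rmorphXn; ring.
Qed.

Lemma in_sum_ideal_endo (phi : {rmorphism B -> B}) (pi d e : A) (u : B)
    (q m h : nat) (s : seq A) :
  (forall a, exists a', phi (j a) = j a') -> phi (j pi) = j pi ->
  j d = D -> j pi * u = D -> phi u = D ^+ q * u + j e -> (0 < q)%N -> (h <= m)%N ->
  in_sum_ideal (m + h) (phi (D ^+ m * \sum_(i < size s) j s`_i * u ^+ i)).
Proof.
move=> phij phipi jd ju phiu q0 hm; rewrite mulr_sumr rmorph_sum.
apply: big_ind => [|b c|i _]; [exact: in_sum_ideal0|exact: in_sum_idealD|].
have [a phia] := phij s`_i.
rewrite mulrCA rmorphM phia; apply: in_sum_idealZ.
rewrite -{1}ju rmorphM !rmorphXn rmorphM phipi phiu exprMn -mulrA -exprD.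
exact: in_sum_ideal_exp jd ju q0 hm.
Qed.

End SumIdeal.

(** * The ring [A[d/y]] before completion *)

Section AdjoinFrac.
Variables (A : comPzRingType) (d y : A).
Local Notation R := (adjoin_frac d y).
Local Notation toR := (to_adjoin_frac d y).

Definition adjoin_frac_gen : R := @adjoin_gen A (away y) (to_away y) (away_frac y d 1).

(** In the localization, [y * (c / y^n) = 0] means that a power of [y] kills [y * c]; one more power
    then kills [c]. *)
Lemma adjoin_frac_torsion_free (a : R) : toR y * a = 0 -> a = 0.
Proof.
case: a => b bP ya0; apply: val_inj; rewrite /=.
have {ya0} : to_away y y * b = away_frac y 0 0 := congr1 val ya0.
have [c [n ->]] := away_fracP b.
rewrite -[_ * _]/(away_mul _ _) away_mulE => /away_frac_eq[k /= hk].
rewrite -[RHS]/(away_frac y 0 0); apply/away_frac_eq; exists k.+1.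
by move: hk; rewrite !mulr0 !mul1r exprSr => <-; ring.
Qed.

Lemma adjoin_frac_genE : toR y * adjoin_frac_gen = toR d.
Proof.
apply: val_inj.
rewrite -[LHS]/(away_mul _ _) -[RHS]/(away_frac y d 0) away_mulE.
by apply/away_frac_eq; exists 0%N; ring.
Qed.

Lemma adjoin_frac_poly (a : R) :
  exists s : seq A, a = \sum_(i < size s) toR s`_i * adjoin_frac_gen ^+ i.
Proof.
case: a => a aP; have /adjoin_predP[s as_] := aP; exists s; apply: val_inj.
rewrite [LHS]as_ rmorph_sum; apply: eq_bigr => i _.
by rewrite rmorphM rmorphXn.
Qed.

End AdjoinFrac.

Theorem lemma1p8 (p : nat) (p_pr : prime p) (E : fieldExtType (padic p_pr))
    (pi : OE E) (pi_unif : is_uniformizer pi)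
    (k : finFieldType) (red : {rmorphism OE E -> k})
    (red_res : is_residue_map pi red) (h : nat) :
  exists M : nat,
    forall (A : comPzRingType) (iota : {rmorphism OE E -> A}) (delta : A -> A)
      (d : A),
    is_prism pi #|k| iota delta d -> transversal_prism pi iota d ->
    let B := adjoin_frac_hat d (iota pi) in
    let j := to_adjoin_frac_hat d (iota pi) in
    forall phi : {rmorphism B -> B},
    (forall a : A, phi (j a) = j (frob pi #|k| iota delta a)) ->
    forall m : nat, (M <= m)%N ->
    forall x : B, exists (a : A) (y : B),
      phi (j d ^+ m * x) = j a + j d ^+ (m + h) * y.
Proof.
exists h => A iota delta d prism _ B j phi phiE m hm.
(* A field has at least two elements; this makes the exponent [q.+1 = #|k| - 1] of [d] in [phi u]
   positive. *)
have [q kq] : exists q, #|k| = q.+2.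
  by case: #|k| (finNzRing_gt1 k) => [|[|q]] // _; exists q.
rewrite kq in prism phiE.
set P : B := j (iota pi); set D := j d.
pose u : B := to_adic _ (adjoin_frac_gen d (iota pi)).
have Pu : P * u = D.
  by rewrite -[D]/(to_adic _ (to_adjoin_frac _ _ d)) -adjoin_frac_genE rmorphM.
have Preg (b : B) : P * b = 0 -> b = 0.
  exact/adic_torsion_free/adjoin_frac_torsion_free.
have phiP : phi P = P by rewrite phiE frob_uniformizer //; apply: prism_delta prism.
have phiu : phi u = D ^+ q.+1 * u + j (delta d).
  (* After multiplication by [P], which [phi] fixes, this is the formula for [phi D]. *)
  apply/eqP; rewrite -subr_eq0; apply/eqP/Preg.
  rewrite mulrBr -{1}phiP -rmorphM Pu phiE /frob rmorphD rmorphM rmorphXn -/P -/D.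
  by rewrite mulrDr mulrCA Pu exprSr; ring.
have phi_poly a : in_sum_ideal j D (m + h) (phi (D ^+ m * to_adic _ a)).
  have [s aE] := adjoin_frac_poly a.
  have -> : to_adic _ a = \sum_(i < size s) j s`_i * u ^+ i.
    by rewrite aE rmorph_sum; apply: eq_bigr => i _; rewrite rmorphM rmorphXn.
  apply: (in_sum_ideal_endo (pi := iota pi) (d := d) (e := delta d)) Pu phiu _ hm => //.
  by move=> b; exists (frob pi q.+2 iota delta b).
move=> x; have [c [T [<- hT]]] := adic_expansion x.
have /choice[al /choice[be hab]] := fun n => phi_poly (c n).
(* Derived completeness at [pi] inverts [(x_n) |-> (x_n - pi x_(n+1))]; thus [g al n] serves as the
   sum of the [pi^i al (n + i)], taken in [A]. *)
have [|g _ gK] := prism_complete prism (f := iota pi).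
  by exists 1, 0; rewrite mulr1 mulr0 addr0.
have hU n : g al n = al n + iota pi * g al n.+1.
  by have /(congr1 (fun f => f n)) <- := gK al; rewrite subrK.
have hjU n : j (g al n) = j (al n) + P * j (g al n.+1).
  by rewrite {1}hU rmorphD rmorphM.
have hphi n : phi (D ^+ m * T n) =
    j (al n) + D ^+ (m + h) * be n + P * phi (D ^+ m * T n.+1).
  by rewrite hT mulrDr rmorphD hab mulrCA rmorphM -/P phiP.
have [V hV] := adic_series be.
exists (g al 0%N), (V 0%N).
(* The errors of the tails satisfy [e n = P * e n.+1], so [e 0] is divisible by every power of
   [P]. *)
pose e n : B := phi (D ^+ m * T n) - (j (g al n) + D ^+ (m + h) * V n).
apply/eqP; rewrite -subr_eq0; apply/eqP.
apply: (@adic_separated _ _ e) => n.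
rewrite /e hphi hjU {1}hV.
move: (phi _) (j _) (j _) => b1 b2 b3.
by rewrite -[to_adic _ _]/P; ring.
Qed.
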